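(* For every real constant $c>1$ there exists $q_0$ such that for every non-prime prime power $q\ge q_0$ (that is, $q=p^n$ with $p$ prime and $n\ge 2$) and every integer $r$ with $r\ge c\log_2 q$, the quantity $$\frac{r}{r+1}-\frac{1}{\sqrt q-1}\cdot\frac{r}{r+1}-\delta$$ exceeds the asymptotic Gilbert–Varshamov bound for locally repairable codes over $\mathbb{F}_q$ with locality $r$, i.e. there exists $\delta\in[0,1-q^{-1}]$ such that $$\frac{r}{r+1}-\frac{1}{\sqrt q-1}\cdot\frac{r}{r+1}-\delta\;>\;1-\min_{0<s\le 1}\left\{\frac{1}{r+1}\log_q\Big([1+(q-1)s]^{r+1}+(q-1)(1-s)^{r+1}\Big)-\delta\log_q s\right\}.$$
   Context: The left-hand side is the lower bound on the rate of $q$-ary locally repairable codes with locality $r$ and relative distance $\delta$ obtained in the paper for square $q$; the right-hand side is the asymptotic Gilbert–Varshamov lower bound for the rate of $q$-ary locally repairable codes with locality $r$ and relative minimum distance $\delta$, valid for $0\le\delta\le 1-q^{-1}$. *)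

(* Defs.v *)
From mathcomp Require Import all_boot all_order all_algebra.
From mathcomp Require Import all_classical all_reals all_analysis.

Set Implicit Arguments.
Unset Strict Implicit.
Unset Printing Implicit Defensive.

Import Order.TTheory GRing.Theory Num.Theory.

Local Open Scope classical_set_scope.
Local Open Scope ring_scope.

Definition nonprime_prime_power (q : nat) : Prop :=
  exists p n : nat, [/\ prime p, (2 <= n)%N & q = (p ^ n)%N].

Definition logb (R : realType) (b x : R) : R := ln x / ln b.

Definition is_minimum (R : realType) (E : set R) (m : R) : Prop :=
  E m /\ lbound E m.

Definition lrc_rate (R : realType) (q r : nat) (delta : R) : R :=
  r%:R / r.+1%:R
  - (Num.sqrt (q%:R : R) - 1)^-1 * (r%:R / r.+1%:R)
  - delta.

Definition gv_objective (R : realType) (q r : nat) (delta s : R) : R :=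
  r.+1%:R^-1 * logb q%:R ((1 + (q%:R - 1) * s) ^+ r.+1
                          + (q%:R - 1) * (1 - s) ^+ r.+1)
  - delta * logb q%:R s.

(* A relation rather than a function of delta, because the minimum over the
   half-open interval need not be attained: for delta = 0 the infimum is only
   approached as s tends to 0, and then no g is related to delta. *)
Definition is_gv_bound (R : realType) (q r : nat) (delta g : R) : Prop :=
  exists2 m : R,
    is_minimum [set gv_objective q r delta s | s in [set s : R | 0 < s <= 1]] m
    & g = 1 - m.

(* Main.v *)
(** For delta = (q-1)/(2q-1), concavity of the logarithm gives
    log_q(1 + (q-1)s) - delta log_q s >= delta + log_q(2 - 1/q), with equality
    at s = 1/q.  Dropping the nonnegative term (q-1)(1-s)^(r+1), the
    Gilbert-Varshamov bound is at most 1 - delta - log_q(2 - 1/q), so it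
    suffices that 1/(r+1) + 1/(sqrt q - 1) < log_q(2 - 1/q).  Multiplied by
    ln q, the left side is at most ln 2 / c + o(1) and the right side tends to
    ln 2 as q grows. *)
Require Import Defs.
From mathcomp Require Import all_boot all_order all_algebra.
From mathcomp Require Import all_classical all_reals all_analysis.
From mathcomp Require Import ring lra.

Import Order.TTheory GRing.Theory Num.Theory.
Import numFieldNormedType.Exports.

Local Open Scope ring_scope.

Lemma ln_le_subr1 (R : realType) (x : R) : 0 < x -> ln x <= x - 1.
Proof.
move=> x0; have := @le_ln1Dx R (x - 1).
by rewrite (_ : 1 + (x - 1) = x); [apply; lra | ring].
Qed.

(** Jensen's inequality for [ln] at the points [1] and [x], obtained from the tangent bound
    [ln y <= y - 1] at [y = x / u] and [y = 1 / u], where [u] is the weighted mean. *)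
Lemma ln_convex_comb_ge (R : realType) (d x : R) :
  0 <= d -> d < 1 -> 0 < x -> d * ln x <= ln (1 - d + d * x).
Proof.
move=> d0 d1 x0; set u := 1 - d + d * x.
have u0 : 0 < u by rewrite /u; nra.
have hx : ln x - ln u <= x / u - 1.
  by rewrite -ln_div ?posrE//; apply: ln_le_subr1; rewrite divr_gt0.
have h1 : - ln u <= u^-1 - 1.
  by rewrite -lnV ?posrE//; apply: ln_le_subr1; rewrite invr_gt0.
(* The weighted tangent bounds cancel because [u] is exactly the mean of [x] and [1]. *)
have e : d * (x / u - 1) + (1 - d) * (u^-1 - 1) = 0.
  have : u * u^-1 = 1 by rewrite divff ?gt_eqF.
  by rewrite {1}/u; nra.
nra.
Qed.

(** Jensen at [x = Q * s]. The weight [(Q - 1) / (2 * Q - 1)] is the one that makes the mean of [1]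
    and [Q * s] a constant multiple of [1 + (Q - 1) * s]. *)
Lemma ln_1DM_ge (R : realType) (Q s : R) :
  1 < Q -> 0 < s ->
  ln ((2 * Q - 1) / Q) + (Q - 1) / (2 * Q - 1) * ln Q
  <= ln (1 + (Q - 1) * s) - (Q - 1) / (2 * Q - 1) * ln s.
Proof.
move=> Q1 s0; set d := (Q - 1) / (2 * Q - 1).
have d0 : 0 <= d by rewrite divr_ge0//; lra.
have d1 : d < 1 by rewrite ltr_pdivrMr; lra.
have Q0 : 0 < Q by lra.
have := ln_convex_comb_ge R d (Q * s) d0 d1 (mulr_gt0 Q0 s0).
have -> : 1 - d + d * (Q * s) = (1 + (Q - 1) * s) / ((2 * Q - 1) / Q).
  by rewrite /d; field; apply/andP; split; lra.
have W0 : 0 < (2 * Q - 1) / Q by rewrite divr_gt0//; lra.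
have V0 : 0 < 1 + (Q - 1) * s by nra.
rewrite ln_div ?posrE// lnM ?posrE//; nra.
Qed.

Section GVObjective.
Variables (R : realType) (q r : nat) (delta : R).
Hypothesis q1 : (1 < q)%N.

Let Q1 : 0 < q%:R - 1 :> R. Proof. by rewrite subr_gt0 ltr1n. Qed.

Lemma gv_base_gt1 (s : R) : 0 < s -> 1 < 1 + (q%:R - 1) * s.
Proof. by move=> s0; rewrite ltrDl mulr_gt0. Qed.

Lemma gv_argument_ge (s : R) : 0 < s <= 1 ->
  (1 + (q%:R - 1) * s) ^+ r.+1
  <= (1 + (q%:R - 1) * s) ^+ r.+1 + (q%:R - 1) * (1 - s) ^+ r.+1.
Proof.
by move=> /andP[s0 s1]; rewrite lerDl mulr_ge0 ?exprn_ge0 ?subr_ge0// -subr_ge0 ltW.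
Qed.

Lemma gv_argument_gt0 (s : R) : 0 < s <= 1 ->
  0 < (1 + (q%:R - 1) * s) ^+ r.+1 + (q%:R - 1) * (1 - s) ^+ r.+1.
Proof.
move=> hs; apply: lt_le_trans (gv_argument_ge s hs).
by have [s0 _] := andP hs; rewrite exprn_gt0// (lt_trans _ (gv_base_gt1 s s0)).
Qed.

(** The exponent [r.+1] cancels the prefactor, leaving a bound free of [r]. It serves twice: to
    control the objective near [s = 0], and for the final estimate. *)
Lemma gv_objective_ge (s : R) : 0 < s <= 1 ->
  logb q%:R (1 + (q%:R - 1) * s) - delta * logb q%:R s
  <= gv_objective q r delta s.
Proof.
move=> hs; have [s0 s1] := andP hs.
have V0 : 0 < 1 + (q%:R - 1) * s by exact: lt_trans (gv_base_gt1 s s0).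
rewrite /gv_objective lerD2r ler_pdivlMl ?ltr0n// /logb mulrA.
rewrite ler_pM2r ?invr_gt0 ?ln_gt0 ?ltr1n// mulr_natl -lnXn//.
by rewrite ler_ln ?posrE ?gv_argument_ge ?gv_argument_gt0 ?exprn_gt0.
Qed.

Lemma continuous_gv_objective (s : R) : 0 < s <= 1 ->
  {for s, continuous (gv_objective q r delta)}.
Proof.
move=> hs; have [s0 _] := andP hs; rewrite /prop_for/= /continuous_at.
have lin (a b : R) : (a + b * x @[x --> s] --> a + b * s)%classic.
  by apply: cvgD; [exact: cvg_cst | apply: cvgM; [exact: cvg_cst | exact: cvg_id]].
have pow (f : R -> R) n : (f x @[x --> s] --> f s)%classic ->
    (f x ^+ n @[x --> s] --> f s ^+ n)%classic.
  by move=> fs; apply: (@cvg_comp _ _ _ f (fun y => y ^+ n) _ _ _ fs); exact: exprn_continuous.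
have logcvg (f : R -> R) : 0 < f s -> (f x @[x --> s] --> f s)%classic ->
    (logb q%:R (f x) @[x --> s] --> logb q%:R (f s))%classic.
  move=> f0 fs; apply: cvgM; last exact: cvg_cst.
  by apply: (@cvg_comp _ _ _ f (@ln R) _ _ _ fs); exact: continuous_ln.
apply: cvgB; apply: cvgM; [exact: cvg_cst | | exact: cvg_cst |].
  apply: (logcvg (fun x => (1 + (q%:R - 1) * x) ^+ r.+1
    + (q%:R - 1) * (1 - x) ^+ r.+1)); first exact: gv_argument_gt0.
  apply: cvgD; first exact: (pow (fun x => 1 + (q%:R - 1) * x)).
  apply: cvgM; first exact: cvg_cst.
  apply: (pow (fun x => 1 - x)).
  by apply: cvgB; [exact: cvg_cst | exact: cvg_id].
by apply: (logcvg id) => //; exact: cvg_id.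
Qed.

(* Below a := q^(-M/delta), with M the value at s = 1, the term
   -delta log_q s alone already exceeds M, so the minimum over [a, 1]
   is the minimum over ]0, 1]. *)
Lemma gv_objective_min : 0 < delta ->
  exists2 s0 : R, 0 < s0 <= 1 &
    forall s, 0 < s <= 1 ->
      gv_objective q r delta s0 <= gv_objective q r delta s.
Proof.
move=> d0; set F := gv_objective q r delta; set L := ln (q%:R : R).
have L0 : 0 < L by rewrite ln_gt0// ltr1n.
have lower s : 0 < s <= 1 -> - (delta * logb q%:R s) <= F s.
  move=> hs; apply: le_trans (gv_objective_ge s hs).
  rewrite lerDr divr_ge0 ?(ltW L0)// ln_ge0//.
  by have [s0 _] := andP hs; rewrite ltW ?gv_base_gt1.
(* This sign gives [a <= 1], so the extreme value theorem applies on [[a, 1]]. *)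
have M0 : 0 <= F 1.
  by apply: le_trans (lower 1 _); rewrite ?ltr01 ?lexx// /logb ln1 mul0r mulr0 oppr0.
set a := expR (- (F 1 * L / delta)).
have a0 : 0 < a by exact: expR_gt0.
have a1 : a <= 1.
  by rewrite -expR0 ler_expR oppr_le0 divr_ge0 ?mulr_ge0 ?(ltW L0) ?(ltW d0).
have [|c] := @EVT_min R F a 1 a1.
  apply: continuous_in_subspaceT => x; rewrite inE/= in_itv/= => /andP[ax x1].
  by apply: continuous_gv_objective; rewrite (lt_le_trans a0 ax) x1.
rewrite in_itv/= => /andP[ac c1] cmin.
exists c; first by rewrite (lt_le_trans a0 ac) c1.
move=> s hs; have [s0 s1] := andP hs.
have [sa|sa] := leP a s; first by apply: cmin; rewrite in_itv/= sa s1.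
apply: le_trans (lower s hs); apply: (@le_trans _ _ (F 1)).
  by apply: cmin; rewrite in_itv/= a1 lexx.
have lns : ln s <= - (F 1 * L / delta).
  by rewrite -(expRK (- _)) ler_ln ?posrE// ltW.
rewrite /logb mulrA -mulNr ler_pdivlMr// -mulrN [leRHS]mulrC -ler_pdivrMr//.
by rewrite lerNr.
Qed.

End GVObjective.

(** With [u] the fourth root of [q], [ln q <= 4 * u] and [sqrt q - 1 >= u ^ 2 / 2], so the first
    term is at most [8 / u]; the second is at most [1 / u]. *)
Lemma ln_div_sqrt_small (R : realType) (eps : R) : 0 < eps ->
  exists q0 : nat, forall q : nat, (q0 <= q)%N ->
    [/\ (1 < q)%N, 1 < Num.sqrt (q%:R : R)
      & ln q%:R / (Num.sqrt q%:R - 1) + (2 * q%:R - 1)^-1 < eps].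
Proof.
(* The part [9 / eps] forces [9 / u < eps]; the added [2] forces [u > 2], hence [t >= 2 * u]. *)
move=> eps0; set K := 9 / eps + 2.
have K2 : 2 < K by rewrite /K ltrDr divr_gt0.
exists (Num.bound (K ^+ 4)) => q hq.
set Q : R := q%:R.
have KQ : K ^+ 4 < Q.
  apply: lt_le_trans (archi_boundP _) _; first by rewrite exprn_ge0//; lra.
  by rewrite ler_nat.
have Q0 : 0 < Q by apply: lt_trans KQ; rewrite exprn_gt0//; lra.
set t := Num.sqrt Q; set u := Num.sqrt t.
have t0 : 0 < t by rewrite sqrtr_gt0.
have u0 : 0 < u by rewrite sqrtr_gt0.
have tQ : t ^+ 2 = Q by rewrite sqr_sqrtr// ltW.
have ut : u ^+ 2 = t by rewrite sqr_sqrtr// ltW.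
have uQ : u ^+ 4 = Q by rewrite -tQ -ut -exprM.
have Ku : K < u.
  by rewrite -(@ltr_pXn2r R 4) ?uQ// nnegrE; lra.
have ueps : 9 / u < eps.
  rewrite ltr_pdivrMr// mulrC -ltr_pdivrMr//.
  by apply: lt_trans Ku; rewrite /K; lra.
have t1 : 2 * u <= t by rewrite -ut expr2; nra.
have t2 : 2 * t <= Q by rewrite -tQ expr2; nra.
have lnQ : ln Q <= 4 * u.
  rewrite -uQ lnXn// -[leLHS]mulr_natl ler_pM2l//.
  by have := ln_le_subr1 R u u0; lra.
split; [by rewrite -(@ltr1n R) -/Q; lra | by lra | ].
apply: le_lt_trans ueps.
have -> : 9 / u = 8 / u + u^-1 by ring.
apply: lerD; last by rewrite lef_pV2 ?posrE; lra.
rewrite ler_pdivrMr; last lra.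
apply: le_trans lnQ _.
rewrite mulrAC ler_pdivlMr// -ut; nra.
Qed.

Theorem proposition1p3 (R : realType) (c : R) (hc : 1 < c) :
  exists q0 : nat, forall q : nat,
    nonprime_prime_power q -> (q0 <= q)%N ->
    forall r : nat, c * logb 2 (q%:R : R) <= r%:R ->
    exists delta g : R,
      [/\ 0 <= delta <= 1 - q%:R^-1,
          is_gv_bound q r delta g
        & lrc_rate q r delta > g].
Proof.
have ln20 : 0 < ln (2 : R) by rewrite ln_gt0// ltr1n.
have c0 : 0 < c by lra.
(* The slack that [c > 1] leaves for all error terms. *)
have eps0 : 0 < ln (2 : R) - ln 2 / c.
  by rewrite subr_gt0 ltr_pdivrMr// ltr_pMr.
have [q0 hq0] := ln_div_sqrt_small R _ eps0.
exists q0 => q _ /hq0[q1 t1 small] r hr.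
set Q : R := q%:R; have Q1 : 1 < Q by rewrite ltr1n.
have Q0 : 0 < Q by lra.
have L0 : 0 < ln Q by rewrite ln_gt0.
set d := (Q - 1) / (2 * Q - 1).
have d0 : 0 < d by rewrite divr_gt0; lra.
have [s0 hs0 smin] := gv_objective_min R q r d q1 d0.
exists d, (1 - gv_objective q r d s0); split.
- have -> : 1 - Q^-1 = (Q - 1) / Q by field; lra.
  by rewrite ltW//= /d ler_pM2l ?lef_pV2 ?posrE; lra.
- exists (gv_objective q r d s0) => //; split; first by exists s0.
  by move=> _ [s hs <-]; exact: smin.
have mge : d + ln ((2 * Q - 1) / Q) / ln Q <= gv_objective q r d s0.
  apply: le_trans (gv_objective_ge R q r d q1 s0 hs0).
  have [s00 _] := andP hs0.
  rewrite /logb mulrA -mulrBl ler_pdivlMr// mulrDl mulfVK ?gt_eqF//.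
  by rewrite addrC; exact: ln_1DM_ge.
(* The ratio of [2] to [(2 * Q - 1) / Q] is [1 + (2 * Q - 1)^-1]; this error is the second summand
   in [small]. *)
have lnW : ln 2 - (2 * Q - 1)^-1 <= ln ((2 * Q - 1) / Q).
  have W0 : 0 < (2 * Q - 1) / Q by rewrite divr_gt0; lra.
  rewrite lerBlDr -lerBlDl -ln_div ?posrE//.
  apply: le_trans (ln_le_subr1 _ _ _) _; first by rewrite divr_gt0.
  rewrite le_eqVlt; apply/orP; left; apply/eqP.
  by field; apply/andP; split; lra.
have r1 : 0 < r.+1%:R :> R by rewrite ltr0n.
have lnr : ln Q / r.+1%:R <= ln 2 / c.
  rewrite ler_pdivrMr// mulrAC ler_pdivlMr//.
  move: hr; rewrite /logb -/Q mulrA ler_pdivrMr// [leLHS]mulrC.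
  move/le_trans; apply.
  by rewrite mulrC ler_pM2l// ler_nat.
have T0 : 0 < Num.sqrt Q - 1 by rewrite subr_gt0.
have loss : r.+1%:R^-1 + (Num.sqrt Q - 1)^-1 < ln ((2 * Q - 1) / Q) / ln Q.
  rewrite ltr_pdivlMr// mulrDl ![_^-1 * _]mulrC.
  apply: lt_le_trans lnW; apply: (le_lt_trans (lerD lnr (lexx _))).
  by rewrite -/Q in small; lra.
have frac : r%:R / r.+1%:R = 1 - r.+1%:R^-1 :> R.
  by rewrite -natr1; field; rewrite natr1 pnatr_eq0.
have V0 : 0 < r.+1%:R^-1 :> R by rewrite invr_gt0.
have T1 : 0 < (Num.sqrt Q - 1)^-1 by rewrite invr_gt0.
(* With [v = 1 / (r + 1)] and [t = 1 / (sqrt Q - 1)], the rate expands to [1 - v - t + t * v - d].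
   The cross term [t * v] is positive, and [loss] with [mge] absorbs [v + t]. *)
have := mulr_gt0 T1 V0; have := lt_le_trans (ltr_leD loss (lexx d)) _.
rewrite [_ + d]addrC => /(_ _ mge); rewrite /lrc_rate frac -/Q mulrBr mulr1.
by move: (Num.sqrt Q - 1)^-1 r.+1%:R^-1 => t v; lra.
Qed.
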